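(* Let $LB$ be a lower bound on the optimal objective function value of the discrete $\alpha$-neighbor $p$-center problem. Then $$LB\, y_i+\max\{LB,d_{ij}\}x_{ij}\le z \quad \forall i,j\in N,\ i\ne j,$$ $$\max\{LB,d_{ij}\}x_{ij}\le z \quad \forall i,j\in N,\ i\ne j,$$ $$\alpha\, LB\, y_i+\sum_{j\in N\setminus\{i\}}\max\{LB,d_{ij}\}x_{ij}\le \alpha z \quad \forall i\in N$$ are valid inequalities for the formulation (APC1), i.e., when adding these inequalities to (APC1), the set of feasible solutions does not change.
   Context: Discrete $\alpha$-neighbor $p$-center problem (d-$\alpha$-$p$CP): given are a finite set of points $N$, a positive integer $p<|N|$, a positive integer $\alpha\le p$, and distances $d_{ij}\ge 0$ for $i,j\in N$. A feasible solution is a set $P\subseteq N$ with $|P|=p$ (open facilities). For $i\in N\setminus P$ let $d_\alpha(P,i)=\min_{A\subseteq P,|A|=\alpha}\max_{j\in A} d_{ij}$, and let $f_\alpha(P)=\max_{i\in N\setminus P} d_\alpha(P,i)$ be the objective function value of $P$. The problem is $\min_{P\subseteq N,|P|=p} f_\alpha(P)$. Formulation (APC1), in variables $y_j$ ($j\in N$), $x_{ij}$ ($i,j\in N$, $i\ne j$), $z$: minimize $z$ subject to - $\sum_{j\in N} y_j = p$; - $\sum_{j\in N\setminus\{i\}} x_{ij}=\alpha(1-y_i)$ for all $i\in N$; - $x_{ij}\le y_j$ for all $i,j\in N$, $i\ne j$; - $d_{ij}x_{ij}\le z$ for all $i,j\in N$, $i\neq j$; - $x_{ij}\in\{0,1\}$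 for all $i,j\in N$, $i\ne j$; $y_j\in\{0,1\}$ for all $j\in N$; $z\in\mathbb{R}$. *)

(* Defs.v *)
From mathcomp Require Import all_boot all_order all_algebra.

Set Implicit Arguments.
Unset Strict Implicit.
Unset Printing Implicit Defensive.

Import Order.TTheory GRing.Theory Num.Theory.

Local Open Scope ring_scope.

Section FiniteExtrema.
Variable R : realFieldType.

(* Minimum and maximum of a nonempty finite list of values; both are 0 on the
   empty list.  Starting the fold from the head of the list avoids the need for
   a neutral element. *)
Definition seq_min (s : seq R) : R := \big[Num.min/head 0 s]_(v <- s) v.
Definition seq_max (s : seq R) : R := \big[Num.max/head 0 s]_(v <- s) v.

End FiniteExtrema.

(* The discrete alpha-neighbor p-center problem on the point set N with
   distances d.  All extrema below range over nonempty sets as soon as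
   0 < alpha <= p < #|N| and #|P| = p. *)
Section Problem.
Variables (R : realFieldType) (N : finType) (d : N -> N -> R) (p alpha : nat).

Definition d_alpha (P : {set N}) (i : N) : R :=
  seq_min [seq seq_max [seq d i j | j in A]
          | A : {set N} in [set B : {set N} | (B \subset P) && (#|B| == alpha)]].

Definition f_alpha (P : {set N}) : R :=
  seq_max [seq d_alpha P i | i in ~: P].

Definition optimal_value : R :=
  seq_min [seq f_alpha P | P : {set N} in [set Q : {set N} | #|Q| == p]].

End Problem.

(* An assignment of values to the variables of (APC1).  The variables x_ij
   exist only for i != j: the diagonal values x i i are never referred to. *)
Record assignment (R : realFieldType) (N : finType) := Assignment {
  yvar : N -> R;
  xvar : N -> N -> R;
  zvar : R
}.

Record APC1_feasible (R : realFieldType) (N : finType) (d : N -> N -> R)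
    (p alpha : nat) (s : assignment R N) : Prop := APC1Feasible {
  APC1_open : \sum_(j : N) yvar s j = p%:R;
  APC1_assign : forall i : N,
    \sum_(j : N | j != i) xvar s i j = alpha%:R * (1 - yvar s i);
  APC1_link : forall i j : N, i != j -> xvar s i j <= yvar s j;
  APC1_radius : forall i j : N, i != j -> d i j * xvar s i j <= zvar s;
  APC1_xbin : forall i j : N, i != j -> xvar s i j = 0 \/ xvar s i j = 1;
  APC1_ybin : forall j : N, yvar s j = 0 \/ yvar s j = 1
}.

(* Main.v *)
Require Import Defs.
From mathcomp Require Import all_boot all_order all_algebra.

(** The point is that the radius [zvar s] of a feasible assignment [s] dominates
    the optimal value of the discrete problem, hence [LB].  Let [P] be the set
    of points with [yvar s j = 1]; it has [p] elements.  For a closed point [i],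
    the points [j] with [xvar s i j = 1] form a subset of [P] of size [alpha],
    all at distance at most [zvar s] from [i]; this set is a candidate in the
    minimum defining [d_alpha d alpha P i].  So
    [optimal_value d p alpha <= f_alpha d alpha P <= zvar s]
    ([optimal_value_le_radius]).

    Given [LB <= zvar s], each inequality is a case split on [yvar s i].  An
    open point has no assignment, so only the terms in [LB] survive.  For a
    closed point the terms in [LB] vanish, and multiplying [xvar s i j] by
    [Num.max LB (d i j)] stays below multiplying it by [zvar s]
    ([max_dist_assign_le]); summing over [j] uses that a closed point has
    exactly [alpha] assignments. *)

Set Implicit Arguments.
Unset Strict Implicit.
Unset Printing Implicit Defensive.

Import Order.TTheory GRing.Theory Num.Theory.

Local Open Scope ring_scope.

Section FiniteExtrema.
Variable R : realFieldType.

Lemma seq_min_le (s : seq R) (v : R) : v \in s -> seq_min s <= v.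
Proof. by move=> vs; apply: (bigmin_inf_seq _ v). Qed.

(** The bound [0 <= b] covers the empty list, whose maximum is 0 by
    convention. *)
Lemma seq_max_le (s : seq R) (b : R) :
  0 <= b -> {in s, forall v, v <= b} -> seq_max s <= b.
Proof.
move=> b_ge0 s_le; rewrite /seq_max big_seq.
apply: bigmax_le => [|v vs]; last exact: s_le.
by case: s s_le => [|v s] s_le //=; apply: s_le; rewrite mem_head.
Qed.

End FiniteExtrema.

(** Cardinality constraints of the formulation are sums of binary values. *)
Lemma sum_binary_card (R : realFieldType) (T : finType) (Q : pred T)
    (x : T -> R) :
  (forall j, Q j -> x j = 0 \/ x j = 1) ->
  \sum_(j | Q j) x j = #|[set j | Q j & x j == 1]|%:R.
Proof.
move=> xbin; rewrite -sum1_card natr_sum (bigID (fun j => x j == 1)) /=.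
rewrite [X in _ + X]big1 ?addr0.
  apply: eq_big => [j|j /andP[_ /eqP->]] //; by rewrite inE.
by move=> j /andP[/xbin[->//|->]]; rewrite eqxx.
Qed.

Section FeasibleAssignment.
Variables (R : realFieldType) (N : finType) (d : N -> N -> R) (p alpha : nat).
Variable s : assignment R N.
Hypothesis d_ge0 : forall i j : N, 0 <= d i j.
Hypothesis feas : APC1_feasible d p alpha s.

Let openset : {set N} := [set j | yvar s j == 1].

Lemma assign_ge0 i j : i != j -> 0 <= xvar s i j.
Proof. by move=> /(APC1_xbin feas)[]->. Qed.

Lemma card_openset : #|openset| = p.
Proof.
apply/eqP; rewrite -(eqr_nat R) -(APC1_open feas).
by rewrite (sum_binary_card (fun j _ => APC1_ybin feas j)).
Qed.

Lemma open_assign0 i j : i != j -> yvar s i = 1 -> xvar s i j = 0.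
Proof.
move=> ij yi; have := APC1_assign feas i; rewrite yi subrr mulr0 => /eqP.
rewrite psumr_eq0 => [/allP/(_ j)|k]; last by rewrite eq_sym; apply: assign_ge0.
by rewrite mem_index_enum eq_sym ij => /(_ isT)/eqP.
Qed.

(** The radius constraints bound [zvar s] from below only through off-diagonal
    pairs, so two distinct points are required. *)
Lemma radius_ge0 : (1 < #|N|)%N -> 0 <= zvar s.
Proof.
move=> /card_gt1P[i [j [_ _ ij]]].
apply: le_trans (APC1_radius feas ij).
by rewrite mulr_ge0 ?assign_ge0.
Qed.

Lemma d_alpha_le_radius i :
  0 <= zvar s -> i \notin openset -> d_alpha d alpha openset i <= zvar s.
Proof.
move=> z_ge0; rewrite inE => yi_neq1.
have yi0 : yvar s i = 0.
  by case: (APC1_ybin feas i) yi_neq1 => // ->; rewrite eqxx.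
pose A := [set j | j != i & xvar s i j == 1].
have cardA : #|A| = alpha.
  apply/eqP; rewrite -(eqr_nat R) -sum_binary_card; last first.
    by move=> j; rewrite eq_sym; apply: (APC1_xbin feas).
  by rewrite (APC1_assign feas) yi0 subr0 mulr1.
have subA : A \subset openset.
  apply/subsetP => j; rewrite !inE eq_sym => /andP[ij /eqP xij].
  have := APC1_link feas ij; rewrite xij.
  by case: (APC1_ybin feas j) => ->; rewrite ?ler10 ?eqxx.
apply: (@le_trans _ _ (seq_max [seq d i j | j in A])).
  by apply/seq_min_le/image_f; rewrite inE subA cardA eqxx.
apply: seq_max_le => // _ /imageP[j jA ->].
move: jA; rewrite inE eq_sym => /andP[ij /eqP xij].
by have := APC1_radius feas ij; rewrite xij mulr1.
Qed.

Lemma optimal_value_le_radius :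
  (1 < #|N|)%N -> optimal_value d p alpha <= zvar s.
Proof.
move=> /radius_ge0 z_ge0.
apply: (@le_trans _ _ (f_alpha d alpha openset)).
  by apply/seq_min_le/image_f; rewrite inE card_openset.
apply: seq_max_le => // _ /imageP[i iP ->].
by apply: d_alpha_le_radius; rewrite // -in_setC.
Qed.

(** Binarity of [xvar s i j] is what permits raising the coefficient from
    [d i j] to any larger lower bound on [zvar s]. *)
Lemma max_dist_assign_le (LB : R) i j : LB <= zvar s -> i != j ->
  Num.max LB (d i j) * xvar s i j <= zvar s * xvar s i j.
Proof.
move=> LBz ij; have := APC1_radius feas ij.
case: (APC1_xbin feas ij) => ->; rewrite ?mulr0 // !mulr1 => dz.
by rewrite ge_max LBz.
Qed.

End FeasibleAssignment.

Theorem theorem2 (R : realFieldType) (N : finType) (d : N -> N -> R)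
    (p alpha : nat) (LB : R)
    (hp : (0 < p < #|N|)%N) (halpha : (0 < alpha <= p)%N)
    (hd : forall i j : N, 0 <= d i j)
    (hLB : LB <= optimal_value d p alpha) :
  forall s : assignment R N,
    (APC1_feasible d p alpha s /\
     [/\ forall i j : N, i != j ->
           LB * yvar s i + Num.max LB (d i j) * xvar s i j <= zvar s,
         forall i j : N, i != j ->
           Num.max LB (d i j) * xvar s i j <= zvar s
       & forall i : N,
           alpha%:R * LB * yvar s i
             + \sum_(j : N | j != i) Num.max LB (d i j) * xvar s i j
           <= alpha%:R * zvar s])
    <-> APC1_feasible d p alpha s.
Proof.
move=> s; split=> [[]//|feas]; split=> //.
have cardN : (1 < #|N|)%N by case/andP: hp; apply: leq_ltn_trans.
have z_ge0 := radius_ge0 hd feas cardN.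
have LBz := le_trans hLB (optimal_value_le_radius hd feas cardN).
have max_le i j (ij : i != j) : Num.max LB (d i j) * xvar s i j <= zvar s.
  apply: le_trans (max_dist_assign_le feas LBz ij) _.
  by case: (APC1_xbin feas ij) => ->; rewrite ?mulr0 ?mulr1.
split=> // [i j ij|i]; case: (APC1_ybin feas i) => yi; rewrite yi.
- by rewrite mulr0 add0r max_le.
- by rewrite (open_assign0 feas ij yi) mulr0 addr0 mulr1.
- rewrite mulr0 add0r.
  have <- : \sum_(j | j != i) zvar s * xvar s i j = alpha%:R * zvar s.
    by rewrite -mulr_sumr (APC1_assign feas) yi subr0 mulr1 mulrC.
  by apply: ler_sum => j ji; apply: (max_dist_assign_le feas LBz); rewrite eq_sym.
- rewrite big1 => [|j ji]; first by rewrite addr0 mulr1 ler_wpM2l.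
  by rewrite (open_assign0 feas _ yi) ?mulr0 // eq_sym.
Qed.
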